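(* Let $J$ be a group and let $n\ge 7$ be an integer such that $\operatorname{Alt}(n-2)$ is not a quotient of $J$. Suppose that $K$ is a group and that a homomorphism $$f:K\to\operatorname{Rub}(n,J)$$ is $J$-set 2-transitive and that its composition with the projection $\operatorname{Rub}(n,J)\to\operatorname{Alt}(n)$ is surjective. Then $f$ is surjective.
   Context: $\operatorname{Sym}(n,J)=J\wr_n\operatorname{Sym}(n)=J^n\rtimes\operatorname{Sym}(n)$ is the wreath product, equal to the group of permutations commuting with $J$ of a $J$-set $X$ with $n$ orbits, all free; $\operatorname{Rub}(n,J)=\operatorname{Sym}(n,J)'$ is its commutator subgroup, which maps to $\operatorname{Alt}(n)\le \operatorname{Sym}(n)$ under the projection $\operatorname{Sym}(n,J) \to \operatorname{Sym}(n)$. A homomorphism $f:K\to\operatorname{Sym}(n,J)$ is $J$-set $i$-transitive if $K$ acts transitively (via $f$, on $X$) on the set of ordered lists of $i$ elements of $X$ that all lie in distinct $J$-orbits. *)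

(* Defs.v *)
From HB Require Import structures.
From mathcomp Require Import all_boot all_fingroup all_solvable.
From mathcomp Require Import boolp.

Set Implicit Arguments.
Unset Strict Implicit.
Unset Printing Implicit Defensive.

Import GroupScope.

Definition surjective (A B : Type) (f : A -> B) : Prop :=
  forall b, exists a, f a = b.

Definition is_quotient (Q G : groupType) : Prop :=
  exists p : {multiplicative G -> Q}, surjective p.

Section CommutatorSubgroup.
Variable G : groupType.

(* The subgroup generated by all commutators [~ x, y] = x^-1 y^-1 x y; MathComp
   only has it for finite groups. *)
Inductive in_commutator_subgroup : G -> Prop :=
  | comm_gen x y : in_commutator_subgroup [~ x, y]
  | comm_one : in_commutator_subgroup 1
  | comm_mul x y : in_commutator_subgroup x -> in_commutator_subgroup y ->
      in_commutator_subgroup (x * y)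
  | comm_inv x : in_commutator_subgroup x -> in_commutator_subgroup x^-1.

Definition commutator_pred : {pred G} :=
  fun x => `[< in_commutator_subgroup x >].

Lemma commutator_predP x :
  reflect (in_commutator_subgroup x) (x \in commutator_pred).
Proof. exact: asboolP. Qed.

Lemma commutator_group_closed : group_closed commutator_pred.
Proof.
split; first exact/commutator_predP/comm_one.
move=> x y /commutator_predP Cx /commutator_predP Cy.
by apply/commutator_predP/comm_mul => //; apply: comm_inv.
Qed.

Record commutator_subgroup := CommutatorSubgroup {
  commutator_val : G;
  commutator_valP : commutator_val \in commutator_pred }.

HB.instance Definition _ := [isSub for commutator_val].
HB.instance Definition _ := [Choice of commutator_subgroup by <:].
HB.instance Definition _ :=
  SubChoice_isSubGroup.Build G commutator_pred commutator_subgroup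
    commutator_group_closed.

End CommutatorSubgroup.

(* [wreath n J] is Sym(n, J) = J^n ><| Sym(n). Permutations compose left to
   right, (s * t) i = t (s i), so Sym(n, J) acts on the right; [wreath_mul] is
   the composition law for the action [wreath_act] below. *)
Record wreath (n : nat) (J : Type) := Wreath {
  wreath_base : {ffun 'I_n -> J};
  wreath_perm : 'S_n }.

Section Wreath.
Variables (n : nat) (J : groupType).

Definition wreath_pair (g : wreath n J) := (wreath_base g, wreath_perm g).
Definition pair_wreath (p : {ffun 'I_n -> J} * 'S_n) := Wreath p.1 p.2.

Lemma wreath_pairK : cancel wreath_pair pair_wreath.
Proof. by case. Qed.

HB.instance Definition _ := Choice.copy (wreath n J) (can_type wreath_pairK).

Definition wreath_mul (g h : wreath n J) : wreath n J :=
  Wreath [ffun i => wreath_base g i * wreath_base h (wreath_perm g i)]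
         (wreath_perm g * wreath_perm h).
Definition wreath_one : wreath n J := Wreath [ffun=> 1] 1.
Definition wreath_inv (g : wreath n J) : wreath n J :=
  Wreath [ffun i => (wreath_base g ((wreath_perm g)^-1 i))^-1]
         (wreath_perm g)^-1.

Lemma wreath_eq (g h : wreath n J) :
  wreath_base g =1 wreath_base h -> wreath_perm g = wreath_perm h -> g = h.
Proof. by case: g h => [a s] [b t] /= /ffunP-> ->. Qed.

Lemma wreath_mulA : associative wreath_mul.
Proof.
by move=> g h k; apply: wreath_eq => [i|] /=; rewrite ?ffunE ?mulgA // permM.
Qed.

Lemma wreath_mul1 : left_id wreath_one wreath_mul.
Proof. by move=> g; apply: wreath_eq => [i|] /=; rewrite ?ffunE ?perm1 mul1g. Qed.

Lemma wreath_1mul : right_id wreath_one wreath_mul.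
Proof. by move=> g; apply: wreath_eq => [i|] /=; rewrite ?ffunE mulg1. Qed.

Lemma wreath_mulV : left_inverse wreath_one wreath_inv wreath_mul.
Proof. by move=> g; apply: wreath_eq => [i|] /=; rewrite ?ffunE mulVg. Qed.

Lemma wreath_Vmul : right_inverse wreath_one wreath_inv wreath_mul.
Proof. by move=> g; apply: wreath_eq => [i|] /=; rewrite ?ffunE ?permK mulgV. Qed.

HB.instance Definition _ := isGroup.Build (wreath n J)
  wreath_mulA wreath_mul1 wreath_1mul wreath_mulV wreath_Vmul.

Lemma wreath_perm_morph : {morph @wreath_perm n J : g h / g * h}.
Proof. by []. Qed.

HB.instance Definition _ :=
  isMultiplicative.Build (wreath n J) 'S_n (@wreath_perm n J) wreath_perm_morph.

(* The free left J-set with n orbits J * {i}. *)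
Definition jset : Type := (J * 'I_n)%type.

Definition jset_smul (j : J) (x : jset) : jset := (j * x.1, x.2).

Definition same_orbit (x y : jset) : Prop := exists j, jset_smul j x = y.

Definition wreath_act (x : jset) (g : wreath n J) : jset :=
  (x.1 * wreath_base g x.2, wreath_perm g x.2).

Lemma wreath_act1 x : wreath_act x 1 = x.
Proof. by case: x => j i; rewrite /wreath_act /= ffunE perm1 mulg1. Qed.

Lemma wreath_actM x g h : wreath_act x (g * h) = wreath_act (wreath_act x g) h.
Proof. by case: x => j i; rewrite /wreath_act /= ffunE permM mulgA. Qed.

Lemma wreath_act_smul j x g :
  wreath_act (jset_smul j x) g = jset_smul j (wreath_act x g).
Proof. by rewrite /wreath_act /jset_smul /= mulgA. Qed.

Lemma wreath_act_inj g h : wreath_act^~ g =1 wreath_act^~ h -> g = h.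
Proof.
move=> eq_gh; apply: wreath_eq => [i|]; last first.
  by apply/permP => i; have /(congr1 snd) := eq_gh (1, i).
by have /(congr1 fst) := eq_gh (1, i); rewrite /= !mul1g.
Qed.

Lemma wreath_act_surj (u : jset -> jset) :
  bijective u -> (forall j x, u (jset_smul j x) = jset_smul j (u x)) ->
  exists g, wreath_act^~ g =1 u.
Proof.
move=> [v uK vK] uJ.
have u1 j i : u (j, i) = jset_smul j (u (1, i)).
  by rewrite -uJ /jset_smul /= mulg1.
have inj_t : injective (fun i => (u (1, i)).2).
  move=> i i' /= eq_t; set a := (u (1, i)).1; set b := (u (1, i')).1.
  have : u (b * a^-1, i) = u (1, i').
    rewrite u1 /jset_smul -/a eq_t -mulgA mulVg mulg1 /b.
    by case: (u (1, i')).
  by move/(can_inj uK)/(congr1 snd).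
exists (Wreath [ffun i => (u (1, i)).1] (perm inj_t)) => -[j i].
by rewrite /wreath_act /= ffunE permE (u1 j).
Qed.

Definition distinct_orbits (i : nat) (s : i.-tuple jset) : Prop :=
  forall r r' : 'I_i, r != r' -> ~ same_orbit (tnth s r) (tnth s r').

Definition jset_transitive (i : nat) (K : groupType)
    (f : {multiplicative K -> wreath n J}) : Prop :=
  forall s t : i.-tuple jset, distinct_orbits s -> distinct_orbits t ->
  exists k : K, forall r : 'I_i, wreath_act (tnth s r) (f k) = tnth t r.

End Wreath.

Notation Rub n J := (commutator_subgroup (wreath n J)).
Notation AltT n := [subg 'Alt_('I_n)]%type.

Section RubProj.
Variables (n : nat) (J : groupType).

Lemma Rub_perm_Alt (g : Rub n J) : wreath_perm (\val g) \in 'Alt_('I_n).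
Proof.
rewrite Alt_even; have /commutator_predP := valP g.
elim: (\val g) / => [x y||x y _ ox _ oy|x _ ox].
- by rewrite /= !odd_permM /= !odd_permV; do 2 case: odd_perm.
- by rewrite /= odd_perm1.
- by rewrite /= odd_permM (negPf ox) (negPf oy).
- by rewrite /= odd_permV.
Qed.

Definition Rub_proj (g : Rub n J) : AltT n := Subg (Rub_perm_Alt g).

Lemma Rub_proj_morph : {morph Rub_proj : g h / g * h}.
Proof. by move=> g h; apply: val_inj. Qed.

HB.instance Definition _ :=
  isMultiplicative.Build (Rub n J) (AltT n) Rub_proj Rub_proj_morph.

End RubProj.

(* Main.v *)
Require Import Defs.
From HB Require Import structures.
From mathcomp Require Import all_boot all_fingroup all_solvable.
From mathcomp Require Import boolp.

Set Implicit Arguments.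
Unset Strict Implicit.
Unset Printing Implicit Defensive.

Import GroupScope.

(** Write H for the image of f in Sym(n, J) and view it as a group of
    J-equivariant permutations of the free J-set X with n orbits.  The proof
    shows that H contains every commutator of Sym(n, J).

    Prescribing values.  For orbits i <> j, an even permutation s and u, v in
    J, some h in H has permutation s and base coordinates u and v at i and j
    ([lift_with_prescribed_values]).  The elements of H that preserve the two
    orbits map onto J x J by 2-transitivity, and onto the stabilizer
    Alt(n - 2) of i and j in Alt(n).  This stabilizer is simple, so by
    Goursat's lemma they map onto the product of the two groups, unless
    Alt(n - 2) is a quotient of J x J, in which case it is a quotient of one
    of the factors.

    Three-cycles of orbits.  Choose g in H with permutation (i j k), fixing
    two more orbits p and q pointwise.  If h in H has permutation (i j)(p q)
    and fixes an orbit r pointwise, then [g, h] again has permutation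
    (i j k), and it fixes p, q, r and everything outside these orbits that g
    fixes.  Iterating over r gives an element that cycles i, j, k and is
    trivial on all other orbits ([exists_cycles_orbits]).

    Three-cycles of points.  If g and h cycle i, j, k and i, j', k', then
    [g, h] is an exact three-cycle x -> x h -> x g -> x on representatives of
    three orbits ([commg_cycles_orbits]).  Prescribing values makes the three
    points arbitrary ([exists_tricycle]), so all the conjugates of such a
    three-cycle lie in H too, and three-cycles belong to the normal core T
    of H.

    Commutators.  T is transitive enough that every g in Sym(n, J) can be
    moved within its coset g T so as to fix all orbits but two given ones
    ([fix_orbits]).  Two elements can be moved in this way onto disjoint pairs
    of orbits, where they commute.  Since T is normal, the commutator of the
    original elements is in T ([commg_tricycles]). *)

Local Notation "x *^ g" := (wreath_act x g) (at level 40, left associativity).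

(** * The action on the free J-set *)

Section Action.
Variables (n : nat) (J : groupType).
Implicit Types (g h w : wreath n J) (x y z : jset n J) (i j k p q : 'I_n).

Lemma wreath_actK g x : x *^ g *^ g^-1 = x.
Proof. by rewrite -wreath_actM mulgV wreath_act1. Qed.

Lemma wreath_actKV g x : x *^ g^-1 *^ g = x.
Proof. by rewrite -wreath_actM mulVg wreath_act1. Qed.

Lemma wreath_act_fixV g x : x *^ g = x -> x *^ g^-1 = x.
Proof. by move=> gx; rewrite -{1}gx wreath_actK. Qed.

Lemma wreath_act_orbit g x : (x *^ g).2 = wreath_perm g x.2.
Proof. by []. Qed.

Lemma wreath_act_fix g x :
  wreath_perm g x.2 = x.2 -> wreath_base g x.2 = 1 -> x *^ g = x.
Proof. by case: x => a i /= pi bi; rewrite /wreath_act /= pi bi mulg1. Qed.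

Lemma wreath_permV g : wreath_perm g^-1 = (wreath_perm g)^-1.
Proof. by []. Qed.

Lemma wreath_baseM g h i :
  wreath_base (g * h) i = wreath_base g i * wreath_base h (wreath_perm g i).
Proof. by rewrite ffunE. Qed.

Lemma wreath_baseV g i :
  wreath_base g^-1 i = (wreath_base g ((wreath_perm g)^-1 i))^-1.
Proof. by rewrite ffunE. Qed.

Lemma wreath_permR g h :
  wreath_perm [~ g, h] = [~ wreath_perm g, wreath_perm h].
Proof. by []. Qed.

Lemma wreath_actR g h x : x *^ [~ g, h] = x *^ g^-1 *^ h^-1 *^ g *^ h.
Proof. by rewrite commgEl conjgE !wreath_actM. Qed.

(** The two fixation lemmas below locate the support of a commutator: [g]
    may be cancelled against its inverse along the path of [x] if it fixes
    [x] both before and after the step by [h^-1]. *)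
Lemma commg_act_fixl g h x :
  x *^ g = x -> x *^ h^-1 *^ g = x *^ h^-1 -> x *^ [~ g, h] = x.
Proof.
move=> gx ghx; rewrite wreath_actR (wreath_act_fixV gx) ghx.
exact: wreath_actKV.
Qed.

Lemma commg_act_fixr g h x :
  x *^ h = x -> x *^ g^-1 *^ h = x *^ g^-1 -> x *^ [~ g, h] = x.
Proof.
by move=> hx hgx; rewrite wreath_actR (wreath_act_fixV hgx) wreath_actKV.
Qed.

(** Only the orbits are cycled: [g ^+ 3] acts on each of them by some
    element of J, which is left free. *)
Definition cycles_orbits g i j k : Prop :=
  [/\ wreath_perm g i = j, wreath_perm g j = k, wreath_perm g k = i &
      forall x, x.2 \notin [:: i; j; k] -> x *^ g = x].

(** Three values and triviality on the other orbits determine the element,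
    by equivariance; see [tricycle_uniq]. *)
Definition tricycle g x y z : Prop :=
  [/\ x *^ g = y, y *^ g = z, z *^ g = x &
      forall v : jset n J, v.2 \notin [:: x.2; y.2; z.2] -> v *^ g = v].

(** The supports meet in the single orbit [i], so the commutator of the two
    underlying permutations is a three-cycle on [i], [j'], [j]. The base
    coordinates of [g] and [h] cancel along each path, which makes the
    three-cycle of points exact even if [g ^+ 3] and [h ^+ 3] are not
    trivial. *)
Lemma commg_cycles_orbits g h i j k j' k' x :
  uniq [:: i; j; k; j'; k'] -> cycles_orbits g i j k ->
  cycles_orbits h i j' k' -> x.2 = i ->
  tricycle [~ g, h] x (x *^ h) (x *^ g).
Proof.
move=> U [gi gj gk gN] [hi hj hk hN] xi.
have Uh : uniq ([:: i; j'; k'] ++ [:: j; k]).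
  rewrite -(perm_uniq (s1 := [:: i, j, k & [:: j'; k']])) // perm_cons.
  by rewrite (perm_catC [:: j; k] [:: j'; k']).
have gfix y p : p \in [:: j'; k'] -> y.2 = p -> y *^ g = y.
  move: U; rewrite (cat_uniq [:: i; j; k]) => /and3P[_ /hasPn out _] pin yp.
  by apply: gN; rewrite yp; apply: out.
have hfix y p : p \in [:: j; k] -> y.2 = p -> y *^ h = y.
  move: Uh; rewrite cat_uniq => /and3P[_ /hasPn out _] pin yp.
  by apply: hN; rewrite yp; apply: out.
have gj' := gfix _ j' (mem_head _ _); have hj' := hfix _ j (mem_head _ _).
have gk' := gfix _ k' (mem_last j' [:: k']).
have hk' := hfix _ k (mem_last j [:: k]).
have gV y p q : wreath_perm g q = p -> y.2 = p -> (y *^ g^-1).2 = q.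
  by move=> <- yp; rewrite wreath_act_orbit yp wreath_permV permK.
have hV y p q : wreath_perm h q = p -> y.2 = p -> (y *^ h^-1).2 = q.
  by move=> <- yp; rewrite wreath_act_orbit yp wreath_permV permK.
split.
- rewrite wreath_actR (wreath_act_fixV (hk' _ _)) ?wreath_actKV //.
  exact: gV gk xi.
- rewrite wreath_actR (wreath_act_fixV (gj' _ _)); last by rewrite -hi -xi.
  by rewrite wreath_actK hj' // -gi -xi.
- rewrite wreath_actR wreath_actK gk' ?wreath_actKV //.
  exact: hV hk xi.
move=> y; rewrite !wreath_act_orbit xi hi gi => yN.
have [yk | yk] := eqVneq y.2 k.
  by apply: commg_act_fixr; [exact: hk' | apply: hj'; exact: gV gj yk].
have [yk' | yk'] := eqVneq y.2 k'.
  by apply: commg_act_fixl; [exact: gk' | apply: gj'; exact: hV hj yk'].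
move: yN; rewrite !inE !negb_or => /and3P[yi yj' yj].
have gy : y *^ g = y by apply: gN; rewrite !inE !negb_or yi yj yk.
have hy : y *^ h = y by apply: hN; rewrite !inE !negb_or yi yj' yk'.
by apply: commg_act_fixl; rewrite ?(wreath_act_fixV hy).
Qed.

Lemma tricycleJ g x y z w :
  tricycle g x y z -> tricycle (g ^ w) (x *^ w) (y *^ w) (z *^ w).
Proof.
have actJ v : v *^ w *^ (g ^ w) = v *^ g *^ w.
  by rewrite conjgE !wreath_actM wreath_actK.
case=> xy yz zx fx; split; rewrite ?actJ ?xy ?yz ?zx // => v vN.
rewrite -[v](wreath_actKV w) actJ fx //; apply: contra vN.
rewrite -[in v.2](wreath_actKV w v) !inE !wreath_act_orbit.
by rewrite !(inj_eq perm_inj).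
Qed.

(** An equivariant map is known on an orbit once it is known at one point. *)
Lemma wreath_act_orbit_eq g h x :
  x *^ g = x *^ h -> forall y, y.2 = x.2 -> y *^ g = y *^ h.
Proof.
move=> gh [b i] /= bi.
have -> : (b, i) = jset_smul (b * x.1^-1) x.
  by rewrite /jset_smul bi mulgVK.
by rewrite !wreath_act_smul gh.
Qed.

Lemma tricycle_uniq g h x y z : tricycle g x y z -> tricycle h x y z -> g = h.
Proof.
move=> [gx gy gz gN] [hx hy hz hN]; apply: wreath_act_inj => w.
have [|wN] := boolP (w.2 \in [:: x.2; y.2; z.2]); last by rewrite gN ?hN.
by rewrite !inE => /or3P[] /eqP; apply: wreath_act_orbit_eq; congruence.
Qed.

Lemma cycles_orbitsJ g i j k w :
  wreath_perm w = 1 -> cycles_orbits g i j k -> cycles_orbits (g ^ w) i j k.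
Proof.
move=> w1 [gi gj gk gN].
have pE : wreath_perm (g ^ w) = wreath_perm g.
  by rewrite [LHS](_ : _ = wreath_perm g ^ wreath_perm w) // w1 conjg1.
split; rewrite ?pE // => x xN.
rewrite conjgE !wreath_actM gN ?wreath_actKV //.
by rewrite wreath_act_orbit wreath_permV w1 invg1 perm1.
Qed.

End Action.

(** * Subgroups, normal cores and commutators *)

Definition subgroup_closed (G : groupType) (H : G -> Prop) : Prop :=
  [/\ H 1, forall g h, H g -> H h -> H (g * h) & forall g, H g -> H g^-1].

Lemma subgroup_closedR (G : groupType) (H : G -> Prop) g h :
  subgroup_closed H -> H g -> H h -> H [~ g, h].
Proof. by case=> _ HM HV Hg Hh; rewrite commgEl conjgE; auto. Qed.

(** The largest normal subgroup contained in [H]; working in it makes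
    conjugation-invariance available without naming generators. *)
Definition conj_core (G : groupType) (H : G -> Prop) (g : G) : Prop :=
  forall w, H (g ^ w).

Lemma conj_core_closed (G : groupType) (H : G -> Prop) :
  subgroup_closed H -> subgroup_closed (conj_core H).
Proof.
case=> H1 HM HV; split=> [w|g h Cg Ch w|g Cg w]; first by rewrite conj1g.
- by rewrite conjMg; apply: HM.
- by rewrite conjVg; apply: HV.
Qed.

Lemma conj_coreJ (G : groupType) (H : G -> Prop) g w :
  conj_core H g -> conj_core H (g ^ w).
Proof. by move=> Cg v; rewrite -conjgM. Qed.

Lemma conj_core_sub (G : groupType) (H : G -> Prop) g : conj_core H g -> H g.
Proof. by move=> /(_ 1); rewrite conjg1. Qed.

(** Exhibits the commutator as a member of the normal closure of [t] and
    [u]: commutators of elements commuting modulo a normal subgroup lie in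
    it. *)
Lemma commg_commuteM (G : groupType) (a b t u : G) :
  commute a b -> [~ a * t, b * u] = t^-1 * u^-1 ^ a * t ^ b * u.
Proof.
move=> ab; rewrite commgEl !conjgE !invgM !mulgA.
by rewrite -(mulgA _ b^-1 a) -(commuteV ab) !mulgA.
Qed.

(** * Three-cycles in a subgroup with two prescribable values *)

Lemma ord_fresh n (s : seq 'I_n) : size s < n -> exists p, p \notin s.
Proof.
move=> lt_s; apply/existsP; rewrite -negb_forall; apply/forallP => sT.
have: #|'I_n| <= size s.
  by apply: leq_trans (card_size s); apply/subset_leq_card/subsetP => i _.
by rewrite card_ord leqNgt lt_s.
Qed.

Section Saturation.
Variables (n : nat) (J : groupType) (H : wreath n J -> Prop).
Hypothesis closedH : subgroup_closed H.
Implicit Types (g h w : wreath n J) (x y z : jset n J) (i j k p q : 'I_n).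

Hypothesis liftH : forall (s : 'S_n) i j (u v : J), ~~ odd_perm s -> i != j ->
  exists2 h, H h &
    [/\ wreath_perm h = s, wreath_base h i = u & wreath_base h j = v].

(** The orbits outside [i], [j], [k] are made pointwise fixed one at a time.
    An element [g] that cycles [i], [j], [k] is replaced by [[~ g, h]],
    where [h] has permutation [s = (i j)(p q)] and fixes the next orbit.
    Since [s] inverts the three-cycle, the permutation is unchanged. Orbits
    already fixed by [g] stay fixed because [s] maps them to orbits fixed by
    [g]; for [p] and [q], which [s] swaps, this is why both are fixed from
    the beginning. *)
Lemma exists_cycles_orbits i j k p q :
  uniq [:: i; j; k; p; q] -> exists2 g, H g & cycles_orbits g i j k.
Proof.
move=> U; pose c : 'S_n := tperm i j * tperm i k.
pose s : 'S_n := tperm i j * tperm p q.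
have := U; rewrite /= !inE !negb_or -!andbA.
case/and5P=> ij ik ip iq /and5P[jk jp jq kp /and3P[kq pq _]].
have sym (a b : 'I_n) : a != b -> b != a by rewrite eq_sym.
have [pi qi ri] := And3 (sym _ _ ip) (sym _ _ iq) (sym _ _ ik).
have [pj qj rj] := And3 (sym _ _ jp) (sym _ _ jq) (sym _ _ jk).
have [pk qk] := conj (sym _ _ kp) (sym _ _ kq).
have si : s i = j by rewrite permM tpermL tpermD.
have sj : s j = i by rewrite permM tpermR tpermD.
have sk : s k = k by rewrite permM !tpermD.
have sp : s p = q by rewrite permM (tpermD ip jp) tpermL.
have sq : s q = p by rewrite permM (tpermD iq jq) tpermR.
have sid r : r \notin [:: i; j; k; p; q] -> s r = r.
  rewrite !inE !negb_or => /and5P[? ? ? ? ?].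
  by rewrite permM !tpermD //; apply: sym.
have cid r : r \notin [:: i; j; k] -> c r = r.
  rewrite !inE !negb_or => /and3P[? ? ?].
  by rewrite permM !tpermD //; apply: sym.
have cs : [~ c, s] = c.
  rewrite commgEl conjMg !tpermJ si sj sk invMg !tpermV.
  rewrite [tperm j i]tpermC -mulgA (mulgA (tperm i j)) tperm2 mul1g.
  rewrite /c [RHS]conjgC tpermJ tpermL [tperm i k j]tpermD //.
  by rewrite [tperm k j]tpermC.
have even_c : ~~ odd_perm c by rewrite odd_permM !odd_tperm ij ik.
have even_s : ~~ odd_perm s by rewrite odd_permM !odd_tperm ij pq.
(* The orbits still to be fixed once [p] and [q] are. *)
have [C [CN pC qC CT]] : exists C : seq 'I_n,
    [/\ {in C, forall r, r \notin [:: i; j; k]}, p \notin C, q \notin C &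
      forall r, r \notin [:: i; j; k; p; q] -> r \in C].
  exists [seq r <- enum 'I_n | r \notin [:: i; j; k; p; q]].
  split=> [r|||r rN]; rewrite mem_filter ?rN ?mem_enum // ?inE ?eqxx ?orbT //.
  by rewrite !negb_or -!andbA => /and5P[-> -> ->].
suff [g Hg [gc gp gq gC]] : exists2 g, H g &
    [/\ wreath_perm g = c, forall x, x.2 = p -> x *^ g = x,
      forall x, x.2 = q -> x *^ g = x &
      forall x, x.2 \in C -> x *^ g = x].
  exists g => //; rewrite /cycles_orbits gc /c !permM.
  rewrite tpermL tpermR [tperm i j k]tpermD // tpermR tpermL tpermD //.
  split=> // x xN.
  have [/gp //| xp] := eqVneq x.2 p.
  have [/gq //| xq] := eqVneq x.2 q.
  apply/gC/CT; move: xN xp xq; rewrite !inE !negb_or.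
  by case/and3P => -> -> -> -> ->.
elim: C CN pC qC {CT} => [|r C IH] CN pC qC.
  have [g Hg [gc gp gq]] := liftH 1 1 even_c pq.
  exists g => //; split=> // x xE;
    apply: wreath_act_fix; rewrite xE // gc cid //.
    by rewrite !inE !negb_or ![p == _]eq_sym ip jp kp.
  by rewrite !inE !negb_or ![q == _]eq_sym iq jq kq.
have [||| g Hg [gc gp gq gC]] := IH.
- by move=> t tC; apply: CN; rewrite inE tC orbT.
- by apply: contra pC; rewrite inE orbC => ->.
- by apply: contra qC; rewrite inE orbC => ->.
have rN : r \notin [:: i; j; k; p; q].
  have := CN r (mem_head _ _); rewrite !inE !negb_or => /and3P[-> -> ->].
  move: pC qC; rewrite !inE !negb_or ![r == _]eq_sym.
  by move=> /andP[-> _] /andP[-> _].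
have rp : r != p by move: pC; rewrite inE negb_or eq_sym => /andP[].
have [h Hh [hs hr _]] := liftH 1 1 even_s rp.
have hV x t : s t = x.2 -> (x *^ h^-1).2 = t.
  by move=> st; rewrite wreath_act_orbit wreath_permV hs -st permK.
have gV x : x.2 \notin [:: i; j; k] -> (x *^ g^-1).2 = x.2.
  by move=> xN; rewrite wreath_act_orbit wreath_permV gc -{1}(cid _ xN) permK.
have hfix x : x.2 = r -> x *^ h = x.
  by move=> xr; apply: wreath_act_fix; rewrite xr // hs sid.
exists [~ g, h]; first exact: subgroup_closedR.
split=> [|x xE|x xE|x].
- by rewrite wreath_permR gc hs.
- by apply: commg_act_fixl; [apply: gp | apply: gq; apply: hV; rewrite sq xE].
- by apply: commg_act_fixl; [apply: gq | apply: gp; apply: hV; rewrite sp xE].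
rewrite inE => /orP[/eqP xr | xC].
  apply: commg_act_fixr; apply: hfix => //.
  by rewrite gV // xr; apply: CN; rewrite mem_head.
have xN : x.2 \notin [:: i; j; k; p; q].
  have := CN x.2; rewrite inE xC orbT => /(_ isT).
  rewrite !inE !negb_or => /and3P[-> -> ->] /=.
  by apply/andP; split; apply: contraTneq xC => ->; [move: pC | move: qC];
    rewrite inE negb_or => /andP[].
by apply: commg_act_fixl; apply: gC => //; rewrite (hV _ x.2) // sid.
Qed.

(** Conjugation by an element of [H] that preserves every orbit, fixes [x]
    and moves the image of [x] to [y] adjusts the value of [g] at [x]. *)
Lemma exists_cycles_orbits_to i j k p q x y :
  uniq [:: i; j; k; p; q] -> x.2 = i -> y.2 = j ->
  exists2 g, H g & cycles_orbits g i j k /\ x *^ g = y.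
Proof.
move=> U xi yj; have [g Hg cg] := exists_cycles_orbits U.
have ij : i != j by move: U; rewrite /= inE negb_or -!andbA => /andP[].
have gj : (x *^ g).2 = j by rewrite wreath_act_orbit xi; case: cg.
have e1 : ~~ odd_perm (1 : 'S_n) by rewrite odd_perm1.
have [w Hw [w1 wi wj]] := liftH 1 ((x *^ g).1^-1 * y.1) e1 ij.
exists (g ^ w); first by case: closedH => _ HM HV; rewrite conjgE; auto.
split; first exact: cycles_orbitsJ.
have wx : x *^ w = x by apply: wreath_act_fix; rewrite ?xi // w1 perm1.
rewrite conjgE !wreath_actM (wreath_act_fixV wx).
rewrite {1}/wreath_act w1 perm1 gj wj mulVKg -yj.
by case: (y).
Qed.

(** The bound on [n] leaves room for two auxiliary orbits [p] and [q], so
    that the two cycles of orbits share only the orbit of [x]. *)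
Lemma exists_tricycle x y z :
  4 < n -> uniq [:: x.2; y.2; z.2] -> exists2 g, H g & tricycle g x y z.
Proof.
move=> n5 U.
have [p pN] := @ord_fresh n [:: x.2; y.2; z.2] (ltn_trans (isT : 3 < 4) n5).
have [q qN] := @ord_fresh n [:: p; x.2; y.2; z.2] n5.
have Uz : uniq [:: x.2; z.2; p; y.2; q].
  have : uniq [:: q; p; x.2; y.2; z.2] by rewrite cons_uniq qN cons_uniq pN U.
  apply: etrans; apply: perm_uniq; apply/seq.permP => a /=.
  by rewrite !addn0; do 4?nat_congr; rewrite ?addnC.
have Uy : uniq [:: x.2; y.2; q; z.2; p].
  move: Uz; apply: etrans; apply: perm_uniq; apply/seq.permP => a /=.
  by rewrite !addn0; do 4?nat_congr; rewrite ?addnC.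
have [g Hg [cg <-]] := @exists_cycles_orbits_to _ _ _ _ _ x z Uz erefl erefl.
have [h Hh [ch <-]] := @exists_cycles_orbits_to _ _ _ _ _ x y Uy erefl erefl.
exists [~ g, h]; first exact: subgroup_closedR.
exact: commg_cycles_orbits Uz cg ch _.
Qed.

End Saturation.

(** * Commutators belong to every normal subgroup containing the three-cycles *)

Section Generation.
Variables (n : nat) (J : groupType) (T : wreath n J -> Prop).
Hypothesis closedT : subgroup_closed T.
Hypothesis normalT : forall g w, T g -> T (g ^ w).
Hypothesis tricycleT : forall x y z : jset n J, uniq [:: x.2; y.2; z.2] ->
  exists2 g, T g & tricycle g x y z.
Implicit Types (g h t w : wreath n J) (x y z v : jset n J) (i j p q r : 'I_n).

(** One three-cycle does it when [x] and [y] lie in distinct orbits. Within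
    one orbit no three-cycle moves [y] to [x], so the point [(1, p)] serves
    as a relay. *)
Lemma move_point_in_orbits p q x y : p != q -> x.2 \notin [:: p; q] ->
  exists2 t, T t & y *^ t = x /\
    forall v, v.2 \notin [:: y.2; x.2; p; q] -> v *^ t = v.
Proof.
case: closedT => _ TM _ pq; rewrite !inE negb_or => /andP[xp xq].
have [yx | yx] := eqVneq y.2 x.2.
  have [|t Tt [yt _ _ tN]] := tricycleT (x := y) (y := (1, p)) (z := (1, q)).
    by rewrite /= !inE negb_or yx xp xq pq.
  have [|s Ts [ps _ _ sN]] := tricycleT (x := (1, p)) (y := x) (z := (1, q)).
    by rewrite /= !inE negb_or [p == _]eq_sym xp xq pq.
  exists (t * s); first exact: TM.
  rewrite wreath_actM yt; split=> // v; rewrite !inE !negb_or.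
  by case/and4P=> vy vx vp vq; rewrite wreath_actM tN ?sN //=;
    rewrite !inE !negb_or ?vy ?vx ?vp ?vq.
have [r [ry rx rpq]] : exists r, [/\ r != y.2, r != x.2 & r \in [:: p; q]].
  have [yp | yp] := eqVneq y.2 p.
    by exists q; rewrite yp !inE eqxx orbT ![q == _]eq_sym.
  by exists p; rewrite !inE eqxx ![p == _]eq_sym.
have [|t Tt [yt _ _ tN]] := tricycleT (x := y) (y := x) (z := (1, r)).
  by rewrite /= !inE negb_or yx ![_ == r]eq_sym ry rx.
exists t => //; split=> // v vN; apply: tN; apply: contra vN.
move: rpq; rewrite !inE => rpq /or3P[->|->|/eqP->]; rewrite ?orbT //.
by case/orP: rpq => ->; rewrite ?orbT.
Qed.

(** The orbits in [C] are corrected one after the other; [p] and [q] provide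
    the room for three-cycles that do not disturb the orbits already fixed. *)
Lemma fix_orbits (C : seq 'I_n) p q g :
  p != q -> p \notin C -> q \notin C ->
  exists2 t, T t & forall x, x.2 \in C -> x *^ (g * t) = x.
Proof.
case: closedT => T1 TM _ pq; elim: C => [|i C IH]; first by exists 1.
rewrite !inE !negb_or => /andP[pi pC] /andP[qi qC].
have [t Tt tC] := IH pC qC.
have [iC | iC] := boolP (i \in C).
  by exists t => // x; rewrite inE => /predU1P[xi|xC]; apply: tC; rewrite ?xi.
set y := (1, i) *^ (g * t).
have [|s Ts [ys sN]] := @move_point_in_orbits p q (1, i) y pq.
  by rewrite !inE negb_or ![i == _]eq_sym pi qi.
exists (t * s); first exact: TM.
move=> x; rewrite inE mulgA wreath_actM => /orP[/eqP xi | xC].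
  rewrite -wreath_actM -[RHS]wreath_act1.
  apply: (wreath_act_orbit_eq (x := (1, i))) => //.
  by rewrite wreath_actM wreath_act1.
rewrite tC // sN // !inE !negb_or; apply/and4P; split.
- apply: contraNneq iC => xy; have yC : y.2 \in C by rewrite -xy.
  have := wreath_actK (g * t) (1, i); rewrite -/y (wreath_act_fixV (tC y yC)).
  by move=> yi; rewrite yi in yC.
- by apply: contraNneq iC => /= <-.
- by apply: contraNneq pC => <-.
- by apply: contraNneq qC => <-.
Qed.

Lemma commute_disjoint_orbits (C D : pred 'I_n) g h :
  (forall x, x.2 \in C -> x *^ g = x) -> (forall x, x.2 \in D -> x *^ h = x) ->
  (forall i, (i \in C) || (i \in D)) -> [~ g, h] = 1.
Proof.
move=> gC hD CD; apply: wreath_act_inj => x; rewrite wreath_act1.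
have [xC | xC] := boolP (x.2 \in C); last have xD := CD x.2.
  have [xD | xD] := boolP (x.2 \in D).
    by apply: commg_act_fixl; rewrite ?(wreath_act_fixV (hD _ xD)); apply: gC.
  apply: commg_act_fixl; first exact: gC.
  have /orP[/gC // | /hD] := CD (x *^ h^-1).2.
  by rewrite wreath_actKV => E; rewrite -E gC.
rewrite (negPf xC) /= in xD.
apply: commg_act_fixr; first exact: hD.
have /orP[/gC | /hD //] := CD (x *^ g^-1).2.
by rewrite wreath_actKV => E; rewrite -E hD.
Qed.

(** Modulo [T], the elements [g] and [h] have representatives supported on
    the disjoint pairs of orbits [p], [q] and [r], [s], which commute. *)
Lemma commg_tricycles g h : 3 < n -> T [~ g, h].
Proof.
case: closedT => _ TM TV n4.
have [p _] := @ord_fresh n [::] (ltn_trans (isT : 0 < 3) n4).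
have [q qN] := @ord_fresh n [:: p] (ltn_trans (isT : 1 < 3) n4).
have [r rN] := @ord_fresh n [:: q; p] (ltn_trans (isT : 2 < 3) n4).
have [s sN] := @ord_fresh n [:: r; q; p] n4.
have fixout i j k : j != i -> exists2 t, T t &
    forall x, x.2 \in predC (mem [:: i; j]) -> x *^ (k * t) = x.
  move=> ij; pose C := [seq a <- enum 'I_n | a \notin [:: i; j]].
  have [|||t Tt tC] := @fix_orbits C i j k;
    rewrite ?mem_filter ?inE ?eqxx ?orbT //.
    by rewrite eq_sym.
  by exists t => // x xC; apply: tC; rewrite mem_filter mem_enum andbT.
have [|t Tt tC] := fixout p q g; first by move: qN; rewrite inE.
have [|u Tu uC] := fixout r s h; first by move: sN; rewrite inE => /norP[].
have comm1 : [~ g * t, h * u] = 1.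
  apply: commute_disjoint_orbits tC uC _ => i; rewrite -negb_and.
  move: rN sN; rewrite !inE !negb_or ![r == _]eq_sym ![s == _]eq_sym.
  case/andP=> qr pr /and3P[_ qs ps].
  apply/negP.
  by case/andP=> /orP[]/eqP-> /orP[]/eqP E; move: qr pr qs ps; rewrite E eqxx.
rewrite -[g](mulgK t) -[h](mulgK u) commg_commuteM; last exact/commgP/eqP.
have Tt' := TV _ Tt; have Tu' := TV _ Tu; rewrite !invgK.
exact: (TM _ _ (TM _ _ (TM _ _ Tt (normalT _ Tu)) (normalT _ Tt')) Tu').
Qed.
End Generation.

(** * Two-point stabilizers in the symmetric group *)

Lemma lift_perm_fix m (t : 'S_m.+1) i :
  t i = i -> exists s, t = lift_perm i i s.
Proof.
move=> ti; have tN k : t (lift i k) != i.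
  by rewrite -{2}ti (inj_eq perm_inj) eq_sym neq_lift.
pose f k := odflt k (unlift i (t (lift i k))).
have fE k : lift i (f k) = t (lift i k).
  by rewrite /f; have := tN k; rewrite eq_sym => /unlift_some[k' -> ->].
have f_inj : injective f.
  by move=> k k' /(congr1 (lift i)); rewrite !fE => /perm_inj/lift_inj.
exists (perm f_inj); apply/permP => k.
have [k'|] := unliftP i k => ->; last by rewrite lift_perm_id.
by rewrite lift_perm_lift permE fE.
Qed.

(** Identifies the symmetric group of degree [m] with the stabilizer of [i]
    and [j], evenness included. The description is symmetric in [i] and [j],
    which a formula by iterated [lift_perm] is not; the symmetry is used
    when the two factors of J x J are exchanged. *)
Definition stabilizer_embedding m n (E : 'S_m -> 'S_n) i j : Prop :=
  [/\ {morph E : s t / s * t}, injective E, forall s, E s = s :> bool &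
      forall t : 'S_n, t i = i /\ t j = j <-> exists s, E s = t].

Lemma stabilizer_embedding_sym m n (E : 'S_m -> 'S_n) i j :
  stabilizer_embedding E i j -> stabilizer_embedding E j i.
Proof. by case=> EM EI Eo ES; split=> // t; rewrite -ES; split=> -[]. Qed.

Lemma exists_stabilizer_embedding m (i j : 'I_m.+2) :
  i != j -> exists E : 'S_m -> 'S_m.+2, stabilizer_embedding E i j.
Proof.
case/unlift_some=> j' jE _.
have Einj k (i0 : 'I_k.+1) : injective (lift_perm i0 i0).
  move=> s t /permP st; apply/permP => a; apply: (@lift_inj _ i0).
  by rewrite -!(lift_perm_lift i0 i0).
exists (fun s => lift_perm i i (lift_perm j' j' s)); split=> [s t||s|t].
- by rewrite !lift_permM.
- by move=> s t /Einj/Einj.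
- by rewrite !odd_lift_perm !addbb !addFb.
split=> [[ti tj]|[s <-]]; last first.
  by rewrite jE lift_perm_lift !lift_perm_id.
have [t' tE] := lift_perm_fix ti.
have tj' : t' j' = j'.
  by apply: (@lift_inj _ i); rewrite -(lift_perm_lift i i) -tE -jE.
by have [s sE] := lift_perm_fix tj'; exists s; rewrite -sE.
Qed.

(** * Prescribing a permutation and two base coordinates *)

Section Lifting.
Variables (m n : nat) (J : groupType) (H : wreath n J -> Prop).
Hypothesis closedH : subgroup_closed H.
Hypothesis evenH : forall h, H h -> ~~ odd_perm (wreath_perm h).
Hypothesis transH : forall i j i' j' (u v : J), i != j -> i' != j' ->
  exists2 h, H h & [/\ wreath_perm h i = i', wreath_perm h j = j',
                      wreath_base h i = u & wreath_base h j = v].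
Hypothesis ontoH : forall s : 'S_n, ~~ odd_perm s ->
  exists2 h, H h & wreath_perm h = s.
Hypothesis m5 : 4 < m.
Implicit Types (g h : wreath n J) (i j : 'I_n) (u v : J).

Section Embedding.
Variables (E : 'S_m -> 'S_n) (i j : 'I_n).
Hypothesis embE : stabilizer_embedding E i j.

(** Taken with [D] the trivial subgroup of J, for the elements of [H] that
    fix the orbits [i] and [j] pointwise, and with [D] all of J, for those
    that fix [j] pointwise and only preserve [i]. *)
Definition perms_over (D : J -> Prop) : {set 'S_m} :=
  [set s | `[< exists2 h, H h & [/\ wreath_perm h = E s,
                                   D (wreath_base h i) &
                                   wreath_base h j = 1] >]].

Lemma perms_overP (D : J -> Prop) s :
  reflect (exists2 h, H h & [/\ wreath_perm h = E s,
                               D (wreath_base h i) & wreath_base h j = 1])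
          (s \in perms_over D).
Proof. by rewrite inE; apply: asboolP. Qed.

Lemma embedding_fix s : E s i = i /\ E s j = j.
Proof. by case: embE => _ _ _ /(_ (E s)) ->; exists s. Qed.

Lemma embedding1 : E 1 = 1.
Proof. by case: embE => EM _ _ _; apply: (mulgI (E 1)); rewrite -EM !mulg1. Qed.

Lemma embeddingV s : E s^-1 = (E s)^-1.
Proof.
by case: embE => EM _ _ _; apply: (mulgI (E s)); rewrite -EM !mulgV embedding1.
Qed.

(** [perms_over D] is normal in the simple group Alt(m): it is normalized by
    the permutations of the elements of [H] that preserve [i] and [j], and
    these are all the even ones. *)
Lemma perms_over_full_or_trivial (D : J -> Prop) :
  subgroup_closed D -> (forall u v, D u -> D (u ^ v)) ->
  (forall s : 'S_m, ~~ odd_perm s -> s \in perms_over D) \/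
  (forall s, s \in perms_over D -> s = 1).
Proof.
move=> [D1 DM DV] DJ; have [EM Ei Eo ES] := embE.
have [H1 HM HV] := closedH.
have gP : group_set (perms_over D).
  apply/group_setP; split=> [|s t].
    by apply/perms_overP; exists 1 => //; rewrite embedding1 !ffunE.
  case/perms_overP=> g Hg [gE gi gj] /perms_overP[h Hh [hE hi hj]].
  apply/perms_overP; exists (g * h); first exact: HM.
  have [si sj] := embedding_fix s.
  rewrite wreath_perm_morph !wreath_baseM gE si sj gj hj mulg1 EM hE.
  by split=> //; apply: DM.
have sub : perms_over D \subset 'Alt_('I_m).
  apply/subsetP => s /perms_overP[h Hh [hE _ _]].
  by rewrite Alt_even -Eo -hE evenH.
have norm : 'Alt_('I_m) \subset 'N(perms_over D).
  apply/normsP => s; rewrite Alt_even => es; apply/eqP.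
  rewrite eqEcard cardJg leqnn andbT.
  apply/subsetP => _ /imsetP[t /perms_overP[h Hh [hE hi hj]] ->].
  have [|w Hw wE] := ontoH (s := E s); first by rewrite Eo.
  apply/perms_overP; exists (h ^ w); first by rewrite conjgE; auto.
  have [si sj] := embedding_fix s; have [ti tj] := embedding_fix t.
  have Vi : (E s)^-1 i = i by rewrite -{1}si permK.
  have Vj : (E s)^-1 j = j by rewrite -{1}sj permK.
  rewrite conjgE !wreath_perm_morph !wreath_baseM !wreath_baseV wreath_permV.
  rewrite wE hE !Vi !Vj ti tj hj mul1g mulVg !EM embeddingV; split=> //.
  by rewrite -conjgE; apply: DJ.
have /simpleP[_ sAlt] : simple 'Alt_('I_m).
  by apply: simple_Alt5; rewrite card_ord.
have /sAlt[] : (Group gP <| 'Alt_('I_m))%g by rewrite /normal sub.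
  by move=> /= P1; right=> s; rewrite P1 => /set1P.
by move=> /= PA; left=> s es; rewrite PA Alt_even.
Qed.

(** The elements of [H] that preserve [i], fix [j] pointwise and act on [i]
    by [u] exist by 2-transitivity, and triviality on the fixer of both
    orbits says that they share one permutation. Sending [u] to it is a
    homomorphism from J, onto Alt(m) by fullness. *)
Lemma quotient_of_perms_over :
  (forall s, s \in perms_over (fun u => u = 1) -> s = 1) ->
  (forall s : 'S_m, ~~ odd_perm s -> s \in perms_over (fun=> True)) ->
  i != j -> is_quotient (AltT m) J.
Proof.
move=> triv full ij; have [EM Ei Eo ES] := embE.
have [H1 HM HV] := closedH.
pose R u (s : 'S_m) := exists2 h, H h & [/\ wreath_perm h = E s,
  wreath_base h i = u & wreath_base h j = 1].
have RM u v s t : R u s -> R v t -> R (u * v) (s * t).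
  move=> [g Hg [gE gi gj]] [h Hh [hE hi hj]]; exists (g * h); first exact: HM.
  have [si sj] := embedding_fix s.
  by rewrite wreath_perm_morph !wreath_baseM gE si sj gj hj mulg1 EM hE gi hi.
have RV u s : R u s -> R u^-1 s^-1.
  move=> [g Hg [gE gi gj]]; exists g^-1; first exact: HV.
  have [si sj] := embedding_fix s.
  have Vi : (E s)^-1 i = i by rewrite -{1}si permK.
  have Vj : (E s)^-1 j = j by rewrite -{1}sj permK.
  by rewrite wreath_permV !wreath_baseV gE Vi Vj gi gj invg1 embeddingV.
have R_uniq u s t : R u s -> R u t -> s = t.
  move=> Rs /RV Rt; apply/eqP; rewrite -divg_eq1; apply/eqP/triv/perms_overP.
  by have := RM _ _ _ _ Rs Rt; rewrite mulgV.
have even_R u s : R u s -> s \in 'Alt_('I_m).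
  by case=> h Hh [hE _ _]; rewrite Alt_even -Eo -hE evenH.
have /choice[phi phiP] u : exists s, R u s.
  have [h Hh [hi hj ui uj]] := transH u 1 ij ij.
  by have /ES[s sE] := conj hi hj; exists s, h.
pose psi u : AltT m := Subg (even_R u _ (phiP u)).
have psiM : {morph psi : u v / u * v}.
  by move=> u v; apply: val_inj; apply: R_uniq (phiP _) _; apply: RM.
pose Psi : {multiplicative J -> AltT m} :=
  HB.pack psi (isMultiplicative.Build J (AltT m) psi psiM).
exists Psi => -[s sA].
have := sA; rewrite Alt_even => /full/perms_overP[h Hh [hE _ hj]].
exists (wreath_base h i); apply: val_inj; apply: R_uniq (phiP _) _.
by exists h.
Qed.
End Embedding.

(** The case analysis of Goursat's lemma. If the pointwise fixer of [i] and
    [j] induces only the identity, then Alt(m) is a quotient of the factor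
    of J at [i] when the fixer of [j] induces all of Alt(m), and of the
    factor at [j] otherwise; both are excluded. *)
Lemma lift_with_prescribed_values :
  n = m.+2 -> ~ is_quotient (AltT m) J ->
  forall (s : 'S_n) i j u v, ~~ odd_perm s -> i != j -> exists2 h, H h &
    [/\ wreath_perm h = s, wreath_base h i = u & wreath_base h j = v].
Proof.
move=> nE notQ s i j u v es ij.
have [E embE] : exists E : 'S_m -> 'S_n, stabilizer_embedding E i j.
  by move: i j ij; rewrite nE => i j; apply: exists_stabilizer_embedding.
have embE' := stabilizer_embedding_sym embE.
have [EM Ei Eo ES] := embE; have [H1 HM HV] := closedH.
have closed1 : subgroup_closed (fun u : J => u = 1).
  by split=> // [a b -> ->|a ->]; rewrite ?mulg1 ?invg1.
have J1 (a b : J) : a = 1 -> a ^ b = 1 by move=> ->; rewrite conj1g.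
have closedT : subgroup_closed (fun _ : J => True) by split.
have full1 t : ~~ odd_perm t -> t \in perms_over E i j (fun u => u = 1).
  have [full | triv] := perms_over_full_or_trivial embE closed1 J1.
    exact: full.
  case: notQ.
  have [full | trivT] :=
    perms_over_full_or_trivial embE closedT (fun _ _ => id).
    exact: (quotient_of_perms_over embE).
  apply: (quotient_of_perms_over embE'); last by rewrite eq_sym.
    move=> r /perms_overP[h Hh [hE hj hi]].
    by apply: triv; apply/perms_overP; exists h.
  (* Any lift [h] of [E r] is corrected at [i] by an element of [H] with the
     same value there and fixing [j]; its permutation is trivial by [trivT]. *)
  move=> r er; have [|h Hh hE] := ontoH (s := E r); first by rewrite Eo.
  have [ri rj] := embedding_fix embE r.
  have [g Hg [gi gj gu gv]] := transH (wreath_base h i) 1 ij ij.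
  have /ES[q qE] := conj gi gj.
  have q1 : q = 1 by apply: trivT; apply/perms_overP; exists g.
  have g1 : wreath_perm g = 1 by rewrite -qE q1 (embedding1 embE).
  apply/perms_overP; exists (g^-1 * h); first by apply: HM => //; apply: HV.
  rewrite wreath_perm_morph !wreath_baseM !wreath_baseV wreath_permV g1 invg1.
  by rewrite mul1g !perm1 hE gu mulVg.
(* An element with the right values has the right permutation up to one fixing
   [i] and [j], which [full1] lifts without changing the values. *)
have ij' : s i != s j by rewrite (inj_eq perm_inj).
have [g Hg [gi gj gu gv]] := transH u v ij ij'.
have fixij : (s * (wreath_perm g)^-1) i = i /\ (s * (wreath_perm g)^-1) j = j.
  by rewrite !permM -gi -gj !permK.
have /ES[t tE] := fixij.
have [|h Hh [hE hi hj]] := perms_overP _ _ _ _ _ (full1 t _).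
  by rewrite -Eo tE odd_permM odd_permV (negPf es) (negPf (evenH Hg)).
exists (h * g); first exact: HM.
have [ti tj] := embedding_fix embE t.
rewrite wreath_perm_morph !wreath_baseM hE ti tj hi hj gu gv !mul1g.
by rewrite tE mulgVK.
Qed.
End Lifting.

(** * Surjectivity *)

Theorem theorem3p4p2 (J : groupType) (n : nat) (hn : 7 <= n)
    (hJ : ~ is_quotient (AltT (n - 2)) J)
    (K : groupType) (f : {multiplicative K -> Rub n J})
    (hf2 : jset_transitive 2 (\val \o f : {multiplicative K -> wreath n J}))
    (hfAlt : surjective (@Rub_proj n J \o f)) :
  surjective f.
Proof.
pose F : {multiplicative K -> wreath n J} := \val \o f.
pose H (g : wreath n J) := exists k, F k = g.
have F1 : F 1 = 1 by apply: (mulgI (F 1)); rewrite -gmulfM !mulg1.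
have closedH : subgroup_closed H.
  split=> [|_ _ [k <-] [l <-]|_ [k <-]]; first by exists 1.
  - by exists (k * l); apply: gmulfM.
  - by exists k^-1; apply: (mulgI (F k)); rewrite -gmulfM !mulgV.
have evenH h : H h -> ~~ odd_perm (wreath_perm h).
  by case=> k <-; rewrite -Alt_even; apply: Rub_perm_Alt.
have ontoH (s : 'S_n) : ~~ odd_perm s -> exists2 h, H h & wreath_perm h = s.
  rewrite -Alt_even => sA; have [k kE] := hfAlt (Subg sA).
  by exists (\val (f k)); [exists k | have := congr1 val kE].
have transH (i j i' j' : 'I_n) (u v : J) : i != j -> i' != j' ->
    exists2 h, H h & [/\ wreath_perm h i = i', wreath_perm h j = j',
                        wreath_base h i = u & wreath_base h j = v].
  have distinct (a b : J) (p q : 'I_n) :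
      p != q -> distinct_orbits [tuple (a, p); (b, q)].
    move=> pq r r' rr' [c /(congr1 snd)] /=; move: rr'.
    case: r r' => [[|[|//]] ?] [[|[|//]] ?] //= _ /eqP.
      by rewrite (negPf pq).
    by rewrite eq_sym (negPf pq).
  move=> ij ij'.
  have [k kE] := hf2 _ _ (distinct 1 1 _ _ ij) (distinct u v _ _ ij').
  have := kE (@Ordinal 2 0 isT); have := kE (@Ordinal 2 1 isT).
  rewrite /wreath_act /= !mul1g => -[kv kj] [ku ki].
  by exists (\val (f k)); [exists k | split].
have n2E : n = (n - 2).+2 by rewrite -addn2 subnK // (leq_trans _ hn).
have n5 : 4 < n - 2 by rewrite -ltnS -ltnS -n2E.
have liftH :=
  lift_with_prescribed_values closedH evenH transH ontoH n5 n2E hJ.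
have tricycleT (x y z : jset n J) : uniq [:: x.2; y.2; z.2] ->
    exists2 g, conj_core H g & tricycle g x y z.
  have n5' : 4 < n by apply: leq_trans hn.
  move=> U; have [g Hg xyz] := exists_tricycle closedH liftH n5' U.
  exists g => // w.
  have [|g' Hg'] := exists_tricycle closedH liftH n5'
    (x := x *^ w) (y := y *^ w) (z := z *^ w).
    by rewrite !wreath_act_orbit (map_inj_uniq perm_inj [:: x.2; y.2; z.2]).
  by move=> /(tricycle_uniq (tricycleJ w xyz)) ->.
have commT g h : H [~ g, h].
  apply: conj_core_sub.
  apply: (commg_tricycles (conj_core_closed closedH)) => //.
    exact: conj_coreJ.
  by apply: leq_trans hn.
have rubH g : in_commutator_subgroup g -> H g.
  have [H1 HM HV] := closedH.
  by elim=> {g} [g h||g h _ Hg _ Hh|g _ Hg]; auto.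
move=> b; have /commutator_predP/rubH[k kE] := valP b.
by exists k; apply: val_inj.
Qed.
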